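(* Let $\mathcal{M}$ be a three dimensional contact manifold with Darboux coordinates $(x,y,z)$, contact form $\sigma=x\,dy+dz$ and volume form $d\mu=d\sigma\wedge\sigma$. The Hamiltonian differential operator $J_{LP}(\alpha)$ associated to the Lie--Poisson bracket $$\{\mathfrak{H},\mathfrak{K}\}(\alpha)=-\int_{\mathcal{M}}\langle\alpha,[X_H,X_K]_{JL}\rangle\,d\mu$$ on $\mathfrak{X}^*_{con}(\mathcal{M})$, that is, the operator defined by $$\{\mathfrak{H},\mathfrak{K}\}(\alpha)=-\int_{\mathcal{M}}\langle X_H,J_{LP}(\alpha)X_K\rangle\,d\mu ,$$ is, for $\alpha=\alpha_xdx+\alpha_ydy+\alpha_zdz$, $$J_{LP}(\alpha)=-\begin{pmatrix}\alpha_x\partial_x+\partial_x\cdot\alpha_x&\alpha_y\partial_x+\partial_y\cdot\alpha_x&\alpha_z\partial_x+\partial_z\cdot\alpha_x\\ \alpha_x\partial_y+\partial_x\cdot\alpha_y&\alpha_y\partial_y+\partial_y\cdot\alpha_y&\alpha_z\partial_y+\partial_z\cdot\alpha_y\\ \alpha_x\partial_z+\partial_x\cdot\alpha_z&\alpha_y\partial_z+\partial_y\cdot\alpha_z&\alpha_z\partial_z+\partial_z\cdot\alpha_z\end{pmatrix},$$ where $\partial_a\cdot\alpha_b=\alpha_b\,\partial_a+\partial\alpha_b/\partial a$ as an operator. Moreover, assuming $\delta\mathfrak{K}/\delta\alpha=X_K$, the Lie--Poisson equations on $\mathfrak{X}^*_{con}(\mathcal{M})$ are $$\dot\alpha=J_{LP}(\alpha)X_K=-ad^*_{X_K}\alpha=-\mathcal{L}_{X_K}\alpha-(div_{d\mu}X_K)\,\alpha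 .$$
   Context: For a smooth function $K=K(x,y,z)$ the contact vector field is $$X_K=\Big(\frac{\partial K}{\partial y}-x\frac{\partial K}{\partial z}\Big)\frac{\partial}{\partial x}-\frac{\partial K}{\partial x}\frac{\partial}{\partial y}+\Big(-K+x\frac{\partial K}{\partial x}\Big)\frac{\partial}{\partial z}.$$ $[\ ,\ ]_{JL}$ is the Jacobi--Lie bracket of vector fields. The Lie algebra of the group of contact diffeomorphisms is the space $\mathfrak{X}_{con}(\mathcal{M})$ of contact vector fields with bracket $-[\ ,\ ]_{JL}$. Its dual $\mathfrak{X}^*_{con}(\mathcal{M})$ is taken to be the space of one-form densities $\alpha\otimes d\mu$ (written simply $\alpha$) with $d\alpha\wedge\sigma-2\alpha\wedge d\sigma\neq0$, paired with vector fields by $\langle\alpha\otimes d\mu,X\rangle=\int_{\mathcal{M}}\langle\alpha,X\rangle d\mu$. In the bracket, $\mathfrak{H},\mathfrak{K}$ are functionals on $\mathfrak{X}^*_{con}(\mathcal{M})$ with $\delta\mathfrak{H}/\delta\alpha=X_H$ and $\delta\mathfrak{K}/\delta\alpha=X_K$ in $\mathfrak{X}_{con}(\mathcal{M})$. The matrix operator $J_{LP}(\alpha)$ acts on the column of components of a vector field, and $\partial_x,\partial_y,\partial_z$ are the partial derivatives. The coadjoint action is $ad^*_X(\alpha\otimes d\mu)=\mathcal{L}_X(\alpha\otimes d\mu)=(\mathcal{L}_X\alpha+(div_{d\mu}X)\alpha)\otimes d\mu$, where $\mathcal{L}$ is the Lie derivative and $div_{d\mu}X$ is defined by $\mathcal{L}_Xd\mu=(div_{d\mu}X)d\mu$.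 Boundary terms in integrations by parts are assumed to vanish.
   Formalization: The relation defining J_LP is taken with a plus sign, {H,K}(α) = +∫⟨X_H, J_LP(α)X_K⟩dμ: for [X,Y]_JL = XY−YX and the displayed matrix the printed minus sign would force every bracket to vanish. *)

(* Defs.v *)
From HB Require Import structures.
From mathcomp Require Import all_boot all_order all_algebra.
From mathcomp Require Import all_classical all_reals all_analysis.
From mathcomp Require Import ring.

Set Implicit Arguments.
Unset Strict Implicit.
Unset Printing Implicit Defensive.

Import Order.TTheory GRing.Theory Num.Theory.
Import numFieldNormedType.Exports.

Local Open Scope classical_set_scope.
Local Open Scope ring_scope.

(* The manifold is an open subset M of R^3, the range of the Darboux chart.
   Tensor fields on M are given by total component functions on R^3; only
   their values on M are ever used (M is open, so this includes partial
   derivatives at points of M). *)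

Definition ix : 'I_3 := @Ordinal 3 0 isT.
Definition iy : 'I_3 := @Ordinal 3 1 isT.
Definition iz : 'I_3 := @Ordinal 3 2 isT.

Lemma big_ord3 (V : nmodType) (F : 'I_3 -> V) :
  \sum_(i < 3) F i = F ix + F iy + F iz.
Proof.
by rewrite !big_ord_recl big_ord0 addr0 addrA; congr (F _ + F _ + F _);
  exact/val_inj.
Qed.

Lemma ord3_cases (i : 'I_3) : i = ix \/ i = iy \/ i = iz.
Proof.
by case: i => [[|[|[|//]]] ?]; [left|right; left|right; right]; exact/val_inj.
Qed.

Section ContactLiePoisson.
Variable R : realType.

Definition xcoord (p : R * R * R) : R := p.1.1.

Definition basis (a : 'I_3) : R * R * R :=
  ((((a == ix)%:R, (a == iy)%:R), (a == iz)%:R)).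

Definition sfun3 : Type := R * R * R -> R.

(* components X^a, alpha_a, omega_ab, eta_abc in the Darboux coordinates; for
   forms these are the values on coordinate fields, so that
   omega = sum_(a < b) omega_ab dx^a /\ dx^b *)
Definition vfield : Type := 'I_3 -> sfun3.
Definition form1 : Type := 'I_3 -> sfun3.
Definition form2 : Type := 'I_3 -> 'I_3 -> sfun3.
Definition form3 : Type := 'I_3 -> 'I_3 -> 'I_3 -> sfun3.

Definition partial (a : 'I_3) (f : sfun3) : sfun3 :=
  fun p => 'D_(basis a) f p.

Definition smooth (M : set (R * R * R)) (f : sfun3) : Prop :=
  forall (s : seq 'I_3) (p : R * R * R), M p ->
    differentiable (foldr partial f s : R * R * R -> R) p.

Definition smooth1 (M : set (R * R * R)) (al : form1) : Prop :=
  forall a, smooth M (al a).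

Definition ext1 (al : form1) : form2 :=
  fun a b p => partial a (al b) p - partial b (al a) p.

Definition wedge21 (om : form2) (al : form1) : form3 :=
  fun a b c p => om a b p * al c p + om b c p * al a p + om c a p * al b p.

Definition wedge12 (al : form1) (om : form2) : form3 :=
  fun a b c p => al a p * om b c p + al b p * om c a p + al c p * om a b p.

(* x dy + dz *)
Definition sigma : form1 := fun a p =>
  (a == iy)%:R * xcoord p + (a == iz)%:R.

Definition vol : form3 := wedge21 (ext1 sigma) sigma.

Definition leb3 := ((@lebesgue_measure R \x @lebesgue_measure R)
                     \x @lebesgue_measure R)%E.

(* integrals with respect to vol, for the orientation given by (x, y, z) *)
Definition dintegrable (M : set (R * R * R)) (f : sfun3) : Prop :=
  leb3.-integrable M (EFin \o (fun p => f p * vol ix iy iz p)).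

Definition dint (M : set (R * R * R)) (f : sfun3) : R :=
  \int[leb3]_(p in M) (f p * vol ix iy iz p).

Definition contr (al : form1) (X : vfield) : sfun3 :=
  fun p => \sum_a al a p * X a p.

Definition pairing (M : set (R * R * R)) (al : form1) (X : vfield) : R :=
  dint M (contr al X).

Definition contact_vf (K : sfun3) : vfield := fun a p =>
  if a == ix then partial iy K p - xcoord p * partial iz K p
  else if a == iy then - partial ix K p
  else - K p + xcoord p * partial ix K p.

(* [X, Y] = X Y - Y X as derivations *)
Definition JL (X Y : vfield) : vfield := fun a p =>
  \sum_b (X b p * partial b (Y a) p - Y b p * partial b (X a) p).

(* covariant tensor fields of rank k, by components T_(s 0, ..., s (k-1)) *)
Definition cotensor (k : nat) : Type := ('I_k -> 'I_3) -> sfun3.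

Definition Lie (k : nat) (X : vfield) (T : cotensor k) : cotensor k :=
  fun s p =>
    \sum_c X c p * partial c (T s) p +
    \sum_(i < k) \sum_c
       partial (s i) (X c) p * T (fun j => if j == i then c else s j) p.

Definition tensor1 (al : form1) : cotensor 1 := fun s => al (s ord0).

Definition tensor3 (om : form3) : cotensor 3 :=
  fun s => om (s ix) (s iy) (s iz).

(* al (x) om *)
Definition tensor13 (al : form1) (om : form3) : cotensor 4 := fun s p =>
  al (s ord0) p * tensor3 om (s \o lift ord0) p.

Definition Lie1 (X : vfield) (al : form1) : form1 :=
  fun a => Lie X (tensor1 al) (fun=> a).

(* Three-forms are multiples of vol, so the function f with Lie X vol = f vol is
   a quotient of components; see divergenceP. *)
Definition divergence (X : vfield) : sfun3 := fun p =>
  Lie X (tensor3 vol) id p / vol ix iy iz p.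

(* the one-form be such that the Lie derivative along X of the density
   al (x) vol is be (x) vol; see ad_starP *)
Definition ad_star (X : vfield) (al : form1) : form1 := fun a p =>
  Lie X (tensor13 al vol) (nth ix [:: a; ix; iy; iz]) p / vol ix iy iz p.

(* d al /\ sigma - 2 al /\ d sigma is not the zero three-form on M *)
Definition in_dual (M : set (R * R * R)) (al : form1) : Prop :=
  smooth1 M al /\
  exists a b c p, M p /\
    wedge21 (ext1 al) sigma a b c p
      - 2 * wedge12 al (ext1 sigma) a b c p != 0.

Definition functional : Type := form1 -> R.

Definition compactly_supported (M : set (R * R * R)) (be : form1) : Prop :=
  exists C : set (R * R * R), [/\ compact C, C `<=` M &
    forall a p, ~ C p -> be a p = 0].

(* X is the functional derivative of F at al. The dual space is stable under
   al + e be for small e, so values of F outside it do not matter. *)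
Definition is_fderiv (M : set (R * R * R)) (F : functional) (al : form1)
    (X : vfield) : Prop :=
  forall be : form1, smooth1 M be -> compactly_supported M be ->
    is_derive (0 : R) (1 : R)
      (fun e : R => F (fun a p => al a p + e * be a p)) (pairing M be X).

(* value at al of the Lie-Poisson bracket of two functionals whose functional
   derivatives at al are X and Y *)
Definition LP_bracket (M : set (R * R * R)) (al : form1) (X Y : vfield) : R :=
  - dint M (contr al (JL X Y)).

(* the boundary term of the integration by parts of u (d_a v) vanishes *)
Definition no_boundary_term (M : set (R * R * R)) (a : 'I_3) (u v : sfun3)
    : Prop :=
  dintegrable M (partial a (fun p => u p * v p)) /\
  dint M (partial a (fun p => u p * v p)) = 0.

(* the integral defining the bracket converges, and there are no boundary
   terms when al_b (X_K)^a d_a (X_H)^b is integrated by parts *)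
Definition admissible (M : set (R * R * R)) (al : form1) (H K : sfun3)
    : Prop :=
  dintegrable M (contr al (JL (contact_vf H) (contact_vf K))) /\
  forall a b, no_boundary_term M a
    (fun p => al b p * contact_vf K a p) (contact_vf H b).

Definition observable (M : set (R * R * R)) (al : form1) (K : sfun3)
    (F : functional) (H : sfun3) : Prop :=
  [/\ smooth M H, is_fderiv M F al (contact_vf H) & admissible M al H K].

(* the operator d_a . f *)
Definition partial_dot (a : 'I_3) (f : sfun3) (u : sfun3) : sfun3 :=
  fun p => f p * partial a u p + partial a f p * u p.

(* entry in row a and column b of the matrix operator *)
Definition J_entry (al : form1) (a b : 'I_3) (u : sfun3) : sfun3 :=
  fun p => - (al b p * partial a u p + partial_dot b (al a) u p).

Definition J_LP (al : form1) (X : vfield) : form1 :=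
  fun a p => \sum_b J_entry al a b (X b) p.

(* J X_K represents the bracket with K. The sign is the one for which
   dF/dt = {F, K} reads d al/dt = J X_K when [X, Y] = X Y - Y X; since the
   bracket is skew, {F, K} is also minus the integral of <X_K, J X_H>. *)
Definition is_LP_operator (M : set (R * R * R)) (al : form1)
    (J : vfield -> form1) : Prop :=
  forall (F G : functional) (H K : sfun3),
    smooth M K -> is_fderiv M G al (contact_vf K) -> observable M al K F H ->
    LP_bracket M al (contact_vf H) (contact_vf K)
      = pairing M (J (contact_vf K)) (contact_vf H).

Definition velocity (al : R -> form1) (t : R) : form1 :=
  fun a p => 'D_1 (fun s => al s a p) t.

(* dF/dt = {F, G} for the functionals F, where al' is the velocity of al,
   dF/dt = <al', dF/d al> and dG/d al = X_K *)
Definition LP_equation (M : set (R * R * R)) (al al' : form1) (K : sfun3)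
    : Prop :=
  forall (F : functional) (H : sfun3), observable M al K F H ->
    dintegrable M (contr al' (contact_vf H)) ->
    pairing M al' (contact_vf H)
      = LP_bracket M al (contact_vf H) (contact_vf K).

(* be and ga pair equally with the contact vector fields X_H for which the
   pairing and the bracket are defined *)
Definition eq_in_dual (M : set (R * R * R)) (al : form1) (K : sfun3)
    (be ga : form1) : Prop :=
  forall (F : functional) (H : sfun3), observable M al K F H ->
    dintegrable M (contr be (contact_vf H)) ->
    pairing M be (contact_vf H) = pairing M ga (contact_vf H).

Lemma is_derive_xcoord (v p : R * R * R) : is_derive p v xcoord v.1.1.
Proof.
have cvx : h^-1 *: ((xcoord \o shift p) (h *: v) - xcoord p) @[h --> 0^']
    --> v.1.1.
  apply: (@cvg_trans _ (v.1.1 @[h --> (0:R)^'])); last exact: cvg_cst.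
  apply: near_eq_cvg; near=> h.
  rewrite /xcoord /= addrK scalerA mulVf ?scale1r//.
  by near: h; exact: nbhs_dnbhs_neq.
by apply: DeriveDef; [apply/cvg_ex; exists v.1.1 | exact: cvg_lim].
Unshelve. all: by end_near. Qed.

Lemma partial_sigma (a b : 'I_3) (p : R * R * R) :
  partial a (sigma b) p = (b == iy)%:R * (a == ix)%:R.
Proof.
pose f : R * R * R -> R := (b == iy)%:R \*: xcoord + cst (b == iz)%:R.
have df : is_derive p (basis a) f ((b == iy)%:R *: (a == ix)%:R + 0).
  by apply: is_deriveD; apply: is_deriveZ; exact: is_derive_xcoord.
by have := @derive_val _ _ _ _ _ _ _ df; rewrite addr0.
Qed.

Definition epsilon (a b c : 'I_3) : R :=
  (uniq [:: a; b; c])%:R * (-1) ^+ ((b < a)%N + (c < a)%N + (c < b)%N).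

Lemma volE (a b c : 'I_3) : vol a b c = cst (epsilon a b c).
Proof.
apply/funext => p; rewrite /vol /wedge21 /ext1 !partial_sigma /sigma /epsilon.
case: a b c => [[|[|[|//]]] ?] [[|[|[|//]]] ?] [[|[|[|//]]] ?];
  rewrite /= ?inE /eq_op /=; ring.
Qed.

Lemma Lie_tensor3_vol (X : vfield) s p :
  Lie X (tensor3 vol) s p = \sum_(i < 3) \sum_c partial (s i) (X c) p *
    tensor3 vol (fun j => if j == i then c else s j) p.
Proof.
rewrite /Lie big1 ?add0r// => c _.
by rewrite /partial /tensor3 volE derive_cst mulr0.
Qed.

Lemma epsilon_trace (D : 'I_3 -> 'I_3 -> R) (s : 'I_3 -> 'I_3) :
  \sum_(i < 3) \sum_c D (s i) c *
    epsilon (if ix == i then c else s ix) (if iy == i then c else s iy)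
            (if iz == i then c else s iz)
  = (\sum_c D c c) * epsilon (s ix) (s iy) (s iz).
Proof.
rewrite !big_ord3 /eq_op /=.
by have [->|[->|->]] := ord3_cases (s ix);
  have [->|[->|->]] := ord3_cases (s iy);
  have [->|[->|->]] := ord3_cases (s iz);
  rewrite /epsilon /= ?inE /eq_op /=; ring.
Qed.

Lemma divergenceE (X : vfield) p :
  divergence X p = \sum_c partial c (X c) p.
Proof.
rewrite /divergence Lie_tensor3_vol /tensor3.
under eq_bigr do under eq_bigr do rewrite volE /cst.
rewrite (epsilon_trace (fun a c => partial a (X c) p) id) volE /cst /=.
by rewrite mulfK// /epsilon /= expr0 mulr1 oner_eq0.
Qed.

Lemma divergenceP (X : vfield) s p :
  Lie X (tensor3 vol) s p = divergence X p * tensor3 vol s p.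
Proof.
rewrite divergenceE Lie_tensor3_vol /tensor3.
under eq_bigr do under eq_bigr do rewrite volE /cst.
by rewrite (epsilon_trace (fun a c => partial a (X c) p) s) volE /cst.
Qed.

Lemma Lie_density (X : vfield) (al : form1) (s : 'I_4 -> 'I_3) p :
  (forall a, differentiable (al a : R * R * R -> R) p) ->
  Lie X (tensor13 al vol) s p =
  (Lie1 X al (s ord0) p + divergence X p * al (s ord0) p)
    * tensor3 vol (s \o lift ord0) p.
Proof.
move=> dal; set v := tensor3 vol (s \o lift ord0) p.
have dalk a c (k : R) :
    partial c (fun q => al a q * k) p = k * partial c (al a) p.
  rewrite /partial; have -> : (fun q => al a q * k) = k \*: al a.
    by apply/funext => q /=; rewrite mulrC.
  by rewrite (deriveZ k (diff_derivable (dal a))).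
have dT c : partial c (tensor13 al vol s) p = v * partial c (al (s ord0)) p.
  rewrite -dalk; congr partial; apply/funext => q.
  by rewrite /tensor13 /v /tensor3 !volE.
rewrite mulrDl -[divergence X p * _ * _]mulrAC -divergenceP Lie_tensor3_vol.
rewrite /Lie1 /Lie big_ord1 [X in _ + X = _]big_ord_recl addrA; congr (_ + _).
  rewrite mulrDl !mulr_suml; congr (_ + _); apply: eq_bigr => c _.
    by rewrite dT /tensor1 mulrCA mulrC.
  by rewrite /tensor13 /tensor1 !eqxx mulrA.
rewrite mulr_suml; apply: eq_bigr => i _.
rewrite mulr_suml; apply: eq_bigr => c _.
by rewrite /tensor13 /= mulrA mulrAC; congr (_ * _ * _).
Qed.

Lemma ad_starE (X : vfield) (al : form1) a p :
  (forall b, differentiable (al b : R * R * R -> R) p) ->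
  ad_star X al a p = Lie1 X al a p + divergence X p * al a p.
Proof.
move=> dal; rewrite /ad_star Lie_density// /tensor3 !volE /cst /=.
by rewrite mulfK// /epsilon /= expr0 mulr1 oner_eq0.
Qed.

Lemma ad_starP (X : vfield) (al : form1) (s : 'I_4 -> 'I_3) p :
  (forall b, differentiable (al b : R * R * R -> R) p) ->
  Lie X (tensor13 al vol) s p = tensor13 (ad_star X al) vol s p.
Proof. by move=> dal; rewrite Lie_density// -ad_starE. Qed.

End ContactLiePoisson.

(* Main.v *)
(* With S = sum_ab al_a (X_H)^b d_b (X_K)^a one has
     <al, [X_H, X_K]> = S - sum_ab al_b (X_K)^a d_a (X_H)^b,
     <J X_K, X_H> = - S - sum_ab (X_H)^b d_a (al_b (X_K)^a),
   so their sum is minus the sum over a and b of d_a (al_b (X_K)^a (X_H)^b),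
   whose integral vanishes. In coordinates J X_K is - ad^*_{X_K} al, since the
   divergence for vol is the coordinate divergence. *)

Require Import Defs.
From mathcomp Require Import all_boot all_order all_algebra.
From mathcomp Require Import all_classical all_reals all_analysis.
From mathcomp Require Import ring lra.

Set Implicit Arguments.
Unset Strict Implicit.
Unset Printing Implicit Defensive.

Import Order.TTheory GRing.Theory Num.Theory.
Import numFieldNormedType.Exports.
Local Open Scope classical_set_scope.
Local Open Scope ring_scope.

(* The carrier of leb3; the canonical sigma-algebra on R * R * R has another
   display. *)
Local Notation borel3 R :=
  (measurableTypeR R * measurableTypeR R * measurableTypeR R)%type.

(** An open set is the union of the cubes with rational centre and radius that it contains. There
    are countably many of them, and each is measurable for the product sigma-algebra on which [leb3]
    lives. *)
Lemma open_measurable_borel3 (R : realType) (M : set (R * R * R)) :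
  open M -> measurable (M : set (borel3 R)).
Proof.
move=> oM.
pose box (q : rat * rat * rat * rat) : set (R * R * R) :=
  ball (ratr q.1.1.1 : R) (ratr q.2) `*` ball (ratr q.1.1.2 : R) (ratr q.2)
    `*` ball (ratr q.1.2 : R) (ratr q.2).
have mbox q : measurable (box q : set (borel3 R)).
  by apply: measurableX; [apply: measurableX|];
    exact: measurable_realfun.measurable_ball.
(* Cubes not contained in [M] are replaced by the empty set, so that the union runs over a whole
   countable type. *)
pose inner q := if `[< box q `<=` M >] then box q else set0.
suff -> : M = \bigcup_q inner q.
  apply: countable_bigcupT_measurable => [|q]; first exact: countableP.
  by rewrite /inner; case: ifP.
rewrite eqEsubset; split=> p; last first.
  by case=> q _; rewrite /inner; case: asboolP => // qM /qM.
move=> Mp; have /nbhs_ballP[e /= e0 eM] : nbhs p M by exact: open_nbhs_nbhs.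
(* With a centre closer than [r] to [p] in each coordinate, the cube of radius [r] contains [p]; as
   [r < e / 2], it stays in the [e]-ball around [p]. *)
have /rat_in_itvoo[r] : 0 < e / 2 by rewrite divr_gt0.
rewrite in_itv /= => /andP[r0 re].
have near_rat (x : R) : exists q : rat, `|ratr q - x| < ratr r.
  have /rat_in_itvoo[q] : x - ratr r < x + ratr r by lra.
  by rewrite in_itv /= => qx; exists q; rewrite ltr_distl.
have [[qx xq] [[qy yq] [qz zq]]] :=
  (near_rat p.1.1, (near_rat p.1.2, near_rat p.2)).
exists (qx, qy, qz, r) => //; rewrite /inner; case: asboolP => [_|[]].
  by split; [split|].
have close (q : rat) (x y : R) :
    `|ratr q - x| < ratr r -> ball (ratr q : R) (ratr r) y -> ball x e y.
  rewrite -!ball_normE /= distrC => xq' qy'.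
  by rewrite (le_lt_trans (ler_distD (ratr q) _ _))//; lra.
by move=> u [[/= ux uy] uz]; apply: eM; split; [split|];
  [exact: close xq ux|exact: close yq uy|exact: close zq uz].
Qed.

Section Contact.
Variables (R : realType) (M : set (R * R * R)).
Implicit Types (f g K : sfun3 R) (X Y : vfield R) (al : form1 R).

Lemma partialM a f g p :
  derivable f p (Defs.basis R a) -> derivable g p (Defs.basis R a) ->
  partial a (fun q => f q * g q) p = f p * partial a g p + g p * partial a f p.
Proof. exact: deriveM. Qed.

(** The components of [contact_vf K] involve [K] and its first partial derivatives, and are
    themselves differentiated once. *)
Lemma smooth_derivable f a v p : smooth M f -> M p ->
  derivable f p v /\ derivable (partial a f) p v.
Proof.
move=> sf Mp; split; apply: diff_derivable.
- exact: (sf [::]).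
- exact: (sf [:: a]).
Qed.

Lemma derivable_contact_vf K a v p : smooth M K -> M p ->
  derivable (contact_vf K a) p v.
Proof.
move=> sK Mp; have dK := fun b => (smooth_derivable b v sK Mp).2.
have dx : derivable (xcoord (R:=R)) p v.
  exact: (@ex_derive _ _ _ _ _ _ _ (is_derive_xcoord v p)).
rewrite /contact_vf; case: (ord3_cases a) => [->|[->|->]] /=.
- exact: (derivableB (dK iy) (derivableM dx (dK iz))).
- exact: (derivableN (dK ix)).
- exact: (derivableD (derivableN (smooth_derivable ix v sK Mp).1)
    (derivableM dx (dK ix))).
Qed.

(** This is the integration by parts before integrating: once the right side is expanded by the
    Leibniz rule, the identity is polynomial in the values and first partial derivatives at [p]. *)
Lemma contr_JL_J_LP al X Y p :
  (forall a v, derivable (al a) p v) ->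
  (forall a v, derivable (X a) p v) ->
  (forall a v, derivable (Y a) p v) ->
  contr al (JL X Y) p + contr (J_LP al Y) X p =
  - \sum_a \sum_b partial a (fun q => al b q * Y a q * X b q) p.
Proof.
move=> dal dX dY.
have dp a b : partial a (fun q => al b q * Y a q * X b q) p =
    al b p * Y a p * partial a (X b) p +
    X b p * (al b p * partial a (Y a) p + Y a p * partial a (al b) p).
  by rewrite partialM ?partialM//; exact: derivableM.
under eq_bigr do under eq_bigr do rewrite dp.
(* [ring] takes too long on the partial derivatives themselves. *)
have alg (A U V : 'I_3 -> R) (dA dU dV : 'I_3 -> 'I_3 -> R) :
    \sum_a A a * (\sum_b (U b * dV b a - V b * dU b a)) +
    \sum_a (\sum_b - (A b * dV a b + (A a * dV b b + dA b a * V b))) * U a =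
    - \sum_a \sum_b
        (A b * V a * dU a b + U b * (A b * dV a a + V a * dA a b)).
  by rewrite !big_ord3; ring.
exact: (alg (al^~ p) (X^~ p) (Y^~ p) (fun a b => partial a (al b) p)
  (fun a b => partial a (X b) p) (fun a b => partial a (Y b) p)).
Qed.

(** Both sides are minus the sum over [b] of [X^b d_b al_a + al_b d_a X^b + al_a d_b X^b]; the first
    two terms form the Lie derivative, the last one the divergence term. *)
Lemma J_LPE X al a p : (forall b, differentiable (al b : R * R * R -> R) p) ->
  J_LP al X a p = - ad_star X al a p.
Proof.
move=> dal; rewrite ad_starE// divergenceE /Lie1 /Lie big_ord1 /tensor1 eqxx.
rewrite /J_LP /J_entry /partial_dot -big_split mulr_suml -big_split -sumrN /=.
apply: eq_bigr => b _; congr (- _).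
rewrite addrA addrC addrA (mulrC (al b p)) (mulrC (al a p)).
by rewrite -[in RHS](mulrC (partial b (al a) p)).
Qed.

Lemma eq_dint f g : {in M, f =1 g} -> dint M f = dint M g.
Proof. by move=> fg; apply: eq_Rintegral => p /fg ->. Qed.

Hypothesis mM : measurable (M : set (borel3 R)).

Lemma dintegrableD f g : dintegrable M f -> dintegrable M g ->
  dintegrable M (fun p => f p + g p).
Proof.
move=> fi gi; have := integrableD mM fi gi.
apply: (eq_integrable mM) => p _ /=.
by rewrite mulrDl.
Qed.

Lemma dintD f g : dintegrable M f -> dintegrable M g ->
  dint M (fun p => f p + g p) = dint M f + dint M g.
Proof.
move=> fi gi; rewrite /dint -RintegralD//.
by apply: eq_Rintegral => p _; rewrite mulrDl.
Qed.

Lemma dintegrableN f : dintegrable M f -> dintegrable M (fun p => - f p).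
Proof.
by move=> /integrableN; apply: (eq_integrable mM) => p _; rewrite /= mulNr.
Qed.

Lemma dintN f : dintegrable M f -> dint M (fun p => - f p) = - dint M f.
Proof.
move=> fi; rewrite /dint -mulN1r -RintegralZl//.
by apply: eq_Rintegral => p _; rewrite mulNr mulN1r.
Qed.

(** Integrability and vanishing are carried together so that the statement can be iterated over a
    double sum. *)
Lemma dint_sum0 (I : Type) (r : seq I) (f : I -> sfun3 R) :
  (forall i, dintegrable M (f i) /\ dint M (f i) = 0) ->
  dintegrable M (fun p => \sum_(i <- r) f i p) /\
  dint M (fun p => \sum_(i <- r) f i p) = 0.
Proof.
move=> f0; elim: r => [|i r [fi f00]].
  have -> : (fun p => \sum_(i <- [::]) f i p) = cst 0.
    by apply/funext => p; rewrite big_nil.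
  split.
    have := integrable0 (@leb3 R) M.
    by apply: (eq_integrable mM) => p _ /=; rewrite mul0r.
  by rewrite /dint /Rintegral; under eq_integral do rewrite mul0r;
    rewrite integral0.
have -> : (fun p => \sum_(i <- i :: r) f i p) =
    (fun p => f i p + \sum_(i <- r) f i p).
  by apply/funext => p; rewrite big_cons.
have [gi g0] := f0 i; split; first exact: dintegrableD.
by rewrite dintD// g0 f00 addr0.
Qed.

Lemma LP_bracket_J_LP al H K : smooth1 M al -> smooth M H -> smooth M K ->
  admissible M al H K ->
  LP_bracket M al (contact_vf H) (contact_vf K) =
    pairing M (J_LP al (contact_vf K)) (contact_vf H).
Proof.
move=> sal sH sK [iJL nb]; rewrite /LP_bracket /pairing.
set u := contr _ _ in iJL *.
pose d p := \sum_a \sum_b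
  partial a (fun q => al b q * contact_vf K a q * contact_vf H b q) p.
have [di d0] : dintegrable M d /\ dint M d = 0.
  by apply: dint_sum0 => a; apply: dint_sum0 => b; exact: nb.
(* Integrability is at hand for [u] and [d], so the bracket is first turned into the integral of
   [- u - d], whose integrand is then compared with that of the pairing. *)
rewrite -[LHS]subr0 -{1}d0 -!dintN// -dintD//; last 2 first.
- exact: dintegrableN.
- exact: dintegrableN.
apply: eq_dint => p /set_mem Mp.
have : u p + contr (J_LP al (contact_vf K)) (contact_vf H) p = - d p.
  apply: contr_JL_J_LP => a v.
  - exact: (smooth_derivable a v (sal a) Mp).1.
  - exact: derivable_contact_vf.
  - exact: derivable_contact_vf.
by move=> <-; rewrite addKr.
Qed.

End Contact.

Theorem proposition5 (R : realType) (M : set (R * R * R)) (oM : open M) :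
  (forall al : form1 R, in_dual M al -> is_LP_operator M al (J_LP al)) /\
  (forall (al : R -> form1 R) (t : R) (G : functional R) (K : sfun3 R),
     (forall s : R, in_dual M (al s)) ->
     (forall (a : 'I_3) (p : R * R * R), M p ->
        derivable (fun s : R => al s a p) t 1) ->
     smooth M K ->
     is_fderiv M G (al t) (contact_vf K) ->
     [/\ (forall (a : 'I_3) (p : R * R * R), M p ->
           J_LP (al t) (contact_vf K) a p
             = - ad_star (contact_vf K) (al t) a p),
         (forall (a : 'I_3) (p : R * R * R), M p ->
           - ad_star (contact_vf K) (al t) a p
             = - Lie1 (contact_vf K) (al t) a p
               - divergence (contact_vf K) p * al t a p),
         (LP_equation M (al t) (velocity al t) K <->
           eq_in_dual M (al t) K (velocity al t) (J_LP (al t) (contact_vf K)))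
       & ((forall (a : 'I_3) (p : R * R * R), M p ->
            velocity al t a p = J_LP (al t) (contact_vf K) a p) ->
          LP_equation M (al t) (velocity al t) K)]).
Proof.
have mM := open_measurable_borel3 oM.
split=> [al [sal _] F G H K sK _ [sH _ adm]|al t G K dual _ sK _].
  exact: LP_bracket_J_LP.
have [sal _] := dual t.
have dal b p : M p -> differentiable (al t b : R * R * R -> R) p.
  exact: (sal b [::]).
have bracketE F H : observable M (al t) K F H ->
    LP_bracket M (al t) (contact_vf H) (contact_vf K) =
    pairing M (J_LP (al t) (contact_vf K)) (contact_vf H).
  by move=> [sH _ adm]; exact: LP_bracket_J_LP.
split=> [a p Mp|a p Mp||vJ F H obs _].
- by apply: J_LPE => b; exact: dal.
- by rewrite ad_starE ?opprD// => b; exact: dal.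
(* Both statements range over the same observables and integrability condition; only their right
   sides differ, and [bracketE] identifies these. *)
- by split=> eqn F H obs /(eqn F H obs); rewrite (bracketE F H obs).
- rewrite (bracketE F H obs); apply: eq_dint => p /set_mem Mp.
  by apply: eq_bigr => a _; rewrite vJ.
Qed.
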